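(* Let $\lambda>0$, let $\nu$ be a non-negative measure on $(0,\infty)$ with $\int_0^\infty (s\wedge 1)\,\nu(ds)<\infty$, let $f(x)=\int_0^\infty (1-e^{-xs})\,\nu(ds)$, and let $N^f(t)$, $t\ge 0$, be the generalized Poisson counting process associated with $(\lambda,\nu)$ (defined in the context). Then the state probabilities $p_k^f(t)=\Pr\{N^f(t)=k\}$, $k\ge 0$, are solutions to $$\frac{d}{dt}p_k^f(t) = -f(\lambda)\,p_k^f(t)+\sum_{m=1}^k \frac{\lambda^m}{m!}\,p_{k-m}^f(t)\int_0^\infty e^{-s\lambda}s^m\,\nu(ds),\qquad k\ge 0,\ t>0,$$ with initial condition $p_0^f(0)=1$ and $p_k^f(0)=0$ for $k\ge 1$ (for $k=0$ the sum is empty). Moreover, the probability generating function $G^f(u,t)=\mathbb{E}\,u^{N^f(t)}$, $|u|<1$, satisfies the linear homogeneous equation $$\frac{\partial}{\partial t}G^f(u,t)=-f(\lambda(1-u))\,G^f(u,t),\qquad G^f(u,0)=1,$$ and has the form $$G^f(u,t)=e^{-t f(\lambda(1-u))}.$$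
   Context: The generalized Poisson counting process $N^f(t)$, $t\ge0$, associated with $(\lambda,\nu)$ is a non-negative integer-valued process with $N^f(0)=0$, with independent and stationary increments, such that, writing $N^f[t,t+dt)$ for the increment over $[t,t+dt)$, as $dt\downarrow 0$, $$\Pr\{N^f[t,t+dt)=k\}=\begin{cases} dt\,\dfrac{\lambda^k}{k!}\displaystyle\int_0^\infty e^{-\lambda s}s^k\,\nu(ds)+o(dt), & k\ge 1,\\[2mm] 1-dt\displaystyle\int_0^\infty(1-e^{-\lambda s})\,\nu(ds)+o(dt), & k=0.\end{cases}$$ *)

(* Defs.v *)
From HB Require Import structures.
From mathcomp Require Import all_boot all_order all_algebra.
From mathcomp Require Import all_classical all_reals all_analysis.

Set Implicit Arguments.
Unset Strict Implicit.
Unset Printing Implicit Defensive.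

Import Order.TTheory GRing.Theory Num.Theory.
Import numFieldNormedType.Exports.

Local Open Scope classical_set_scope.
Local Open Scope ring_scope.

(* A measure on (0, +oo) is given as a Borel measure on R that is only ever
   integrated over `]0, +oo[. *)
Definition bernstein_fun (R : realType)
    (nu : {measure set (measurableTypeR R) -> \bar R}) (x : R) : R :=
  \int[nu]_(s in `]0, +oo[) (1 - expR (- x * s)).

Definition jump_rate (R : realType) (lambda : R)
    (nu : {measure set (measurableTypeR R) -> \bar R}) (k : nat) : R :=
  lambda ^+ k / k`!%:R *
  \int[nu]_(s in `]0, +oo[) (expR (- lambda * s) * s ^+ k).

Section process.
Context (R : realType) (d : measure_display) (T : measurableType d).
Variable P : probability T R.
Variable N : R -> T -> nat.  (* only times t >= 0 are meaningful *)

(* Integer-valued: subtraction on nat is truncated, and monotone paths are not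
   part of the definition of the process. *)
Definition increment (s t : R) (w : T) : int := (N t w)%:Z - (N s w)%:Z.

(* Increments take countably many values, so arbitrary sets of integers are
   the measurable events. *)
Definition independent_increments : Prop :=
  forall (n : nat) (t : nat -> R) (A : nat -> set int),
    0 <= t 0%N -> (forall i, (i < n)%N -> t i < t i.+1) ->
    P [set w | forall i, (i < n)%N -> A i (increment (t i) (t i.+1) w)] =
    (\prod_(i < n) P [set w | A i (increment (t i) (t i.+1) w)])%E.

Definition stationary_increments : Prop :=
  forall (s t h : R) (A : set int), 0 <= s -> 0 <= t -> 0 <= h ->
    P [set w | A (increment s (s + h) w)] =
    P [set w | A (increment t (t + h) w)].

Definition increment_prob (t h : R) (k : nat) : R :=
  fine (P [set w | increment t (t + h) w = k%:Z]).

Record generalized_poisson (lambda : R)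
    (nu : {measure set (measurableTypeR R) -> \bar R}) : Prop := {
  gp_measurable : forall t, 0 <= t -> measurable_fun setT (N t) ;
  gp_start : {ae P, forall w, N 0 w = 0%N} ;
  gp_independent : independent_increments ;
  gp_stationary : stationary_increments ;
  gp_jump : forall (t : R) (k : nat), 0 <= t -> (1 <= k)%N ->
    (fun h : R => increment_prob t h k) =
    (fun h : R => h * jump_rate lambda nu k) +o_ (0^'+) (fun h : R => h) ;
  gp_no_jump : forall t : R, 0 <= t ->
    (fun h : R => increment_prob t h 0) =
    (fun h : R => 1 - h * bernstein_fun nu lambda) +o_ (0^'+) (fun h : R => h)
}.

Definition state_prob (k : nat) (t : R) : R := fine (P [set w | N t w = k]).

Definition pgf (u t : R) : R := fine ('E_P[fun w => (u ^+ N t w)%R])%E.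

End process.

(* Main.v *)
Require Import Defs.
From HB Require Import structures.
From mathcomp Require Import all_boot all_order all_algebra.
From mathcomp Require Import all_classical all_reals all_analysis.
From mathcomp Require Import measurable_realfun.
From mathcomp Require Import ring lra.
Set Implicit Arguments.
Unset Strict Implicit.
Unset Printing Implicit Defensive.
Import Order.TTheory GRing.Theory Num.Theory.
Import numFieldNormedType.Exports.
Local Open Scope classical_set_scope.
Local Open Scope ring_scope.

(** Write p_k(t) for the state probabilities, r_k for the jump rates
    lambda^k/k! * int e^(-lambda s) s^k nu(ds), and f for the Bernstein function.

    Stationarity, applied to the increments over [t, t+h) and over [0, h), shows
    that every increment has the law of N(h), because N(0) = 0 almost surely. In
    particular increments are almost surely nonnegative. With independence this
    gives the convolution identity
    p_k(t+h) = sum_(m <= k) p_(k-m)(t) p_m(h) ([state_prob_convolution]).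

    Insert the expansions p_0(h) = 1 - h f(lambda) + o(h) and
    p_m(h) = h r_m + o(h). Since probabilities are bounded by 1, the error in
    p_k(t+h) - p_k(t) = h (-f(lambda) p_k(t) + sum_m r_m p_(k-m)(t)) + o(h) is
    uniform in t > 0. Such a uniform one-sided expansion gives the two-sided
    derivative: at t - h it bounds the left difference quotient, and it also
    implies the continuity of the right-hand side ([continuous_of_steps],
    [derive_of_steps]).

    For the generating function G(u, t), the convolution identity gives
    G(u, t+h) = G(u, t) G(u, h) ([pgfD]), and it remains to expand G(u, h) as
    1 - h f(lambda (1-u)) + o(h) ([negligible_pgf_error]) and to apply the same
    derivative criterion. All the series involved are cut at a finite rank n, at
    the cost of a remainder of order |u|^n: for the process it is
    |u|^n Pr(N(h) <> 0) ([pgf_truncation]); for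
    f(lambda (1-u)) = f(lambda) - sum_(k >= 1) u^k r_k it is |u|^n f(lambda), by the
    corresponding estimate for the exponential series under the integral
    ([bernstein_fun_jump_rate]). As |u| < 1, letting n grow after h has tended to 0
    makes the remainders disappear. Finally G(u, t) e^(t f(lambda (1-u)))
    has derivative zero on (0, oo) and tends to 1 at 0, hence is constantly 1. *)

(** * Derivatives from one-sided step estimates *)

(** The relation e(h) = o(h) as h decreases to 0, written with h in place of
    |h| so that it combines directly with step estimates over h > 0. *)
Definition negligible_step (R : realType) (e : R -> R) :=
  forall eps : R, 0 < eps -> \forall h \near 0^'+, `|e h| <= eps * h.

Lemma negligible_step_ex (R : realType) (e : R -> R) (eps : R) :
  negligible_step e -> 0 < eps ->
  exists2 del, 0 < del & forall h, 0 < h -> h < del -> `|e h| <= eps * h.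
Proof.
move=> He e0; have := He _ e0; rewrite near_withinE.
move=> /nbhs_ballP[del /= d0 H]; exists del => // h h0 hd.
by apply: H => //=; rewrite /ball /= sub0r normrN gtr0_norm.
Qed.

Lemma negligible_step_norm (R : realType) (e : R -> R) :
  negligible_step e -> negligible_step (fun h => `|e h|).
Proof.
move=> He eps e0; by apply: filterS (He _ e0) => h; rewrite normr_id.
Qed.

Lemma negligible_step_sum (R : realType) (n : nat) (e : nat -> R -> R) :
  (forall i, (i < n)%N -> negligible_step (e i)) ->
  negligible_step (fun h => \sum_(i < n) `|e i h|).
Proof.
elim: n => [|n IH] He eps e0.
  near=> h; rewrite big_ord0 normr0 mulr_ge0 // ltW //.
have h2 : 0 < eps / 2 by rewrite divr_gt0.
have A1 := He n (ltnSn n) _ h2.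
have A2 := IH (fun i (hi : (i < n)%N) => He i (ltnW hi)) _ h2.
near=> h.
rewrite big_ord_recr /= (splitr eps) mulrDl.
apply: (le_trans (ler_normD _ _)); rewrite normr_id.
by apply: lerD; near: h.
Unshelve. all: by end_near. Qed.

(** An expansion over forward steps whose error does not depend on the
    starting point controls the left difference quotient at t as well: start
    the step of length h at t - h, and replace L (t - h) by L t by continuity. *)
Lemma derive_of_steps (R : realType) (F L e : R -> R) (t : R) :
  negligible_step e -> 0 < t -> {for t, continuous L} ->
  (forall s h, 0 < s -> 0 < h -> `|F (s + h) - F s - h * L s| <= e h) ->
  is_derive t 1 F (L t).
Proof.
move=> He t0 cL HF.
suff H : h^-1 *: ((F \o shift t) (h *: 1) - F t) @[h --> 0^'] --> L t.
  by apply: DeriveDef; [apply/cvg_ex; exists (L t)|apply: cvg_lim].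
apply/cvgrPdist_le => eps e0.
have h2 : 0 < eps / 2 by rewrite divr_gt0.
have [del d0 Hd] := negligible_step_ex He h2.
move/cvgrPdist_le: cL => /(_ _ h2) /nbhs_ballP[r /= r0 Hr].
rewrite near_withinE; apply/nbhs_ballP.
exists (Num.min (Num.min del r) t) => /=; first by rewrite !lt_min d0 r0 t0.
move=> h; rewrite /ball /= sub0r normrN !lt_min => /andP[/andP[hd hr] ht] hn0.
rewrite /= scaler1 [h + t]addrC /GRing.scale /=.
have [h0|h0|h00] := ltrgtP h 0; last by rewrite h00 eqxx in hn0.
- rewrite ltr0_norm // in hd hr ht.
  have tn : 0 < t + h by lra.
  have nh0 : 0 < - h by lra.
  have := HF (t + h) (- h) tn nh0; rewrite addrK => HH.
  have e1 := Hd _ nh0 hd.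
  have e2 := le_trans (ler_norm _) e1.
  have := Hr (t + h); rewrite /ball /= opprD addNKr normrN ltr0_norm //.
  move=> /(_ hr) L1.
  (* the step leads from t + h up to t, over the length - h *)
  rewrite (_ : L t - _ = (L t - L (t + h)) -
      (F t - F (t + h) - - h * L (t + h)) / - h); last by field.
  apply: (le_trans (ler_normB _ _)); rewrite (splitr eps); apply: lerD => //.
  rewrite normrM normfV (gtr0_norm nh0) ler_pdivrMr //.
  exact: (le_trans HH).
- rewrite gtr0_norm // in hd hr ht.
  have e2 := le_trans (ler_norm _) (Hd _ h0 hd).
  have HH := le_trans (HF t h t0 h0) e2.
  rewrite (_ : L t - _ = - ((F (t + h) - F t - h * L t) / h)); last by field.
  rewrite normrN normrM normfV (gtr0_norm h0) ler_pdivrMr //.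
  apply: (le_trans HH); rewrite ler_pM2r //; lra.
Qed.

(** With L bounded by C, a step of small length h moves F by at most (C + 1)
    h, whatever its starting point, so F is locally Lipschitz. *)
Lemma continuous_of_steps (R : realType) (F L e : R -> R) (C t : R) :
  negligible_step e -> 0 < t -> (forall s, 0 < s -> `|L s| <= C) ->
  (forall s h, 0 < s -> 0 < h -> `|F (s + h) - F s - h * L s| <= e h) ->
  {for t, continuous F}.
Proof.
move=> He t0 HL HF.
have C0 : 0 < C + 1 by have := HL t t0; have := normr_ge0 (L t); lra.
have [del d0 Hd] := negligible_step_ex He (@ltr01 R).
have K s h : 0 < s -> 0 < h -> h < del -> `|F (s + h) - F s| <= (C + 1) * h.
  move=> s0 h0 hd.
  rewrite -[F _ - _](subrK (h * L s)) (le_trans (ler_normD _ _)) // addrC.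
  rewrite mulrDl lerD //; last first.
    by rewrite (le_trans (HF _ _ s0 h0)) // (le_trans (ler_norm _)) // Hd.
  by rewrite normrM gtr0_norm // mulrC ler_wpM2r ?HL // ltW.
apply/cvgrPdist_le => eps e0; apply/nbhs_ballP.
exists (Num.min (Num.min del t) (eps / (C + 1))) => /=.
  by rewrite !lt_min d0 t0 divr_gt0.
move=> s; rewrite /ball /= !lt_min => /andP[/andP[sd st]].
rewrite ltr_pdivlMr // => se.
have [lt_ts|lt_st|->] := ltrgtP t s; last by rewrite subrr normr0 ltW.
- rewrite distrC gtr0_norm ?subr_gt0 // in sd st se.
  have := K t (s - t) t0; rewrite subr_gt0 [t + _]addrC subrK distrC.
  by move=> /(_ lt_ts sd) /le_trans; apply; rewrite mulrC ltW.
- rewrite gtr0_norm ?subr_gt0 // in sd st se.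
  have s0 : 0 < s by lra.
  have := K s (t - s) s0; rewrite subr_gt0 [s + _]addrC subrK.
  by move=> /(_ lt_st sd) /le_trans; apply; rewrite mulrC ltW.
Qed.

(** * Truncated power series *)

Lemma eq_of_geometric (R : realType) (a b u C : R) : `|u| < 1 ->
  (forall n, `|a - b| <= C * `|u| ^+ n) -> a = b.
Proof.
move=> u1 H; apply/eqP; rewrite -subr_eq0 -normr_le0.
have c : C * `|u| ^+ n @[n --> \oo] --> C * 0.
  by apply: cvgMr; apply: cvg_expr; rewrite normr_id.
rewrite -(mulr0 C) -(cvg_lim (@Rhausdorff R) c).
apply: limr_ge; first by apply/cvg_ex; eexists; exact: c.
by near=> n; exact: H.
Unshelve. all: by end_near. Qed.

(** Both sides sum a j * b m over the triangle j + m < n. *)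
Lemma cauchy_triangle (R : pzRingType) (a b : nat -> R) (n : nat) :
  \sum_(k < n) \sum_(m < k.+1) a (k - m)%N * b m =
  \sum_(m < n) (\sum_(j < n - m) a j) * b m.
Proof.
elim: n => [|n IH]; first by rewrite !big_ord0.
rewrite big_ord_recr /= IH [RHS]big_ord_recr /= subSnn big_ord1.
rewrite [X in _ + X]big_ord_recr /= subnn addrA -big_split /=; congr (_ + _).
apply: eq_bigr => m _; rewrite -mulrDl subSn ?(ltnW (ltn_ord m)) //.
by rewrite big_ord_recr.
Qed.

(** The coefficients of degree < n of a product of power series in u differ
    from the product of the truncations only by the pairs j, m < n with j + m
    >= n; each of them carries a factor u ^+ (j + m). *)
Lemma cauchy_truncation (R : realDomainType) (u : R) (p q : nat -> R) n :
  `|u| <= 1 -> (forall k, 0 <= p k) -> (forall k, 0 <= q k) ->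
  \sum_(k < n) p k <= 1 -> \sum_(k < n) q k <= 1 ->
  `|\sum_(k < n) u ^+ k * (\sum_(m < k.+1) p (k - m)%N * q m) -
    (\sum_(k < n) u ^+ k * p k) * (\sum_(k < n) u ^+ k * q k)| <= `|u| ^+ n.
Proof.
move=> u1 p0 q0 p1 q1.
pose a k := u ^+ k * p k; pose b k := u ^+ k * q k.
have -> : \sum_(k < n) u ^+ k * (\sum_(m < k.+1) p (k - m)%N * q m) =
    \sum_(k < n) \sum_(m < k.+1) a (k - m)%N * b m.
  apply: eq_bigr => k _; rewrite mulr_sumr; apply: eq_bigr => m _.
  by rewrite /a /b -{1}(subnK (ltn_ord m : (m <= k)%N)) exprD; ring.
rewrite cauchy_triangle mulr_sumr -sumrB (le_trans (ler_norm_sum _ _ _)) //.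
have tail (m : 'I_n) : `|(\sum_(j < n - m) a j) * b m -
    (\sum_(j < n) a j) * b m| <= `|u| ^+ n * q m.
  rewrite distrC -mulrBl -!(big_mkord xpredT a).
  rewrite (big_cat_nat (n := n - m)) ?leq_subr //= [X in X - _]addrC addrK.
  rewrite mulr_suml (le_trans (ler_norm_sum _ _ _)) //.
  apply: (@le_trans _ _ (\sum_(n - m <= j < n) `|u| ^+ n * q m * p j)).
    rewrite !big_nat; apply: ler_sum => j /andP[hj _].
    rewrite /a /b !normrM !normrX (ger0_norm (p0 _)) (ger0_norm (q0 _)).
    rewrite mulrACA -exprD [p j * _]mulrC mulrA.
    rewrite !ler_wpM2r // ler_wiXn2l //.
    by rewrite addnC -leq_subLR.
  rewrite -mulr_sumr ler_piMr ?mulr_ge0 ?exprn_ge0 // (le_trans _ p1) //.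
  rewrite -(big_mkord xpredT p) [leRHS](big_cat_nat (n := n - m)) ?leq_subr //=.
  by rewrite lerDr sumr_ge0.
apply: (le_trans (ler_sum _ (fun m _ => tail m))).
by rewrite -mulr_sumr ler_piMr // exprn_ge0.
Qed.

(** Every term of degree k > K in the exponential series at x * u is at most
    |u| ^+ K.+1 times the term of degree k at x, and the latter terms add up
    to at most expR x - 1. *)
Lemma exp_tail (R : realType) (x u : R) (K : nat) : 0 <= x -> `|u| <= 1 ->
  `|expR (x * u) - \sum_(k < K.+1) (x * u) ^+ k / k`!%:R| <=
  `|u| ^+ K.+1 * (expR x - 1).
Proof.
move=> x0 u1.
have c1 : \sum_(0 <= k < n) exp_coeff (x * u) k @[n --> \oo] --> expR (x * u)
  by exact: is_cvg_series_exp_coeff.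
have c2 : \sum_(0 <= k < n) exp_coeff x k @[n --> \oo] --> expR x
  by exact: is_cvg_series_exp_coeff.
have c3 : `|\sum_(0 <= k < n) exp_coeff (x * u) k -
    \sum_(k < K.+1) (x * u) ^+ k / k`!%:R| @[n --> \oo] -->
  `|expR (x * u) - \sum_(k < K.+1) (x * u) ^+ k / k`!%:R|.
  by apply: cvg_norm; apply: cvgB => //; exact: cvg_cst.
have c4 : `|u| ^+ K.+1 * (\sum_(0 <= k < n) exp_coeff x k - 1) @[n --> \oo] -->
    `|u| ^+ K.+1 * (expR x - 1).
  by apply: cvgMr; apply: cvgB => //; exact: cvg_cst.
rewrite -(cvg_lim (@Rhausdorff R) c3) -(cvg_lim (@Rhausdorff R) c4).
apply: ler_lim; [by apply/cvg_ex; eexists; exact: c3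
  |by apply/cvg_ex; eexists; exact: c4|].
near=> n.
have Kn : (K.+1 <= n)%N by near: n; exact: nbhs_infty_ge.
rewrite (big_cat_nat (n := K.+1)) //= big_mkord addrAC subrr add0r.
rewrite (le_trans (ler_norm_sum _ _ _)) //.
have -> : \sum_(0 <= k < n) exp_coeff x k - 1 = \sum_(1 <= k < n) exp_coeff x k.
  rewrite big_ltn ?(leq_trans _ Kn) //.
  by rewrite /exp_coeff /= expr0 fact0 divr1 addrAC subrr add0r.
apply: (@le_trans _ _ (`|u| ^+ K.+1 * \sum_(K.+1 <= k < n) exp_coeff x k)).
  rewrite mulr_sumr !big_nat; apply: ler_sum => k /andP[Kk _].
  rewrite /exp_coeff /= exprMn [_ * u ^+ k]mulrC -mulrA normrM normrX.
  rewrite [`|x ^+ k / _|]ger0_norm ?divr_ge0 ?exprn_ge0 //.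
  by rewrite ler_wpM2r ?divr_ge0 ?exprn_ge0 // ler_wiXn2l.
rewrite ler_wpM2l ?exprn_ge0 // [leRHS](big_cat_nat (n := K.+1)) //= lerDr.
by apply: sumr_ge0 => k _; rewrite exp_coeff_ge0.
Unshelve. all: by end_near. Qed.

(** * Integrals against the Levy measure *)

Section lincomb.
Context d (T : measurableType d) (R : realType).
Variables (mu : {measure set T -> \bar R}) (D : set T).
Hypothesis mD : measurable D.

Lemma integrable_lincomb n (c : nat -> R) (f : nat -> T -> R) :
  (forall i, (i < n)%N -> mu.-integrable D (EFin \o f i)) ->
  mu.-integrable D (EFin \o (fun x => \sum_(i < n) c i * f i x)).
Proof.
elim: n => [|n IH] H.
  rewrite (_ : EFin \o _ = cst 0%E); first exact: integrable0.
  by apply/funext => x /=; rewrite big_ord0.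
rewrite (_ : EFin \o _ = ((EFin \o (fun x => (\sum_(i < n) c i * f i x)%R)) \+
    (EFin \o (fun x => (c n * f n x)%R)))%E); last first.
  by apply/funext => x /=; rewrite big_ord_recr.
apply: integrableD => //.
  by apply: IH => i hi; exact/H/ltnW.
rewrite (_ : EFin \o _ = (fun x => (c n)%:E * (EFin \o f n) x)%E) //.
by apply: integrableZl => //; exact: H.
Qed.

Lemma Rintegral_lincomb n (c : nat -> R) (f : nat -> T -> R) :
  (forall i, (i < n)%N -> mu.-integrable D (EFin \o f i)) ->
  \int[mu]_(x in D) (\sum_(i < n) c i * f i x) =
  \sum_(i < n) c i * \int[mu]_(x in D) f i x.
Proof.
elim: n => [|n IH] H.
  rewrite big_ord0 (_ : (fun x => _) = fun=> 0); last first.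
    by apply/funext => x; rewrite big_ord0.
  by rewrite /Rintegral integral0.
rewrite big_ord_recr /= -IH; last by move=> i hi; exact/H/ltnW.
rewrite (_ : (fun x => _) = (fun x => \sum_(i < n) c i * f i x + c n * f n x));
  last by apply/funext => x /=; rewrite big_ord_recr.
rewrite RintegralD //.
- by rewrite RintegralZl //; exact: H.
- by apply: integrable_lincomb => i hi; exact/H/ltnW.
- rewrite (_ : EFin \o _ = (fun x => (c n)%:E * (EFin \o f n) x)%E) //.
  by apply: integrableZl => //; exact: H.
Qed.
End lincomb.

Section levy.
Context (R : realType) (nu : {measure set (measurableTypeR R) -> \bar R}).
Hypothesis nu_levy :
  (\int[nu]_(s in `]0%R, +oo[) (Num.min s 1)%:E < +oo)%E.

(** The integrability condition on nu makes integrable every measurable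
    function of order min(s, 1), even though nu may have infinite mass near 0. *)
Lemma integrable_levy (c : R) (f : measurableTypeR R -> R) :
  measurable_fun setT f ->
  (forall s, 0 < s -> `|f s| <= c * Num.min s 1) ->
  nu.-integrable `]0, +oo[ (EFin \o f).
Proof.
move=> mf fc.
have mI : measurable (`]0, +oo[%classic : set (measurableTypeR R)) by [].
have mmin : measurable_fun setT (fun s : measurableTypeR R => Num.min s 1).
  by apply: measurable_minr => //; exact: measurable_id.
apply: (@le_integrable _ _ _ nu _ mI _
  (fun s => c%:E * (EFin \o (fun s => Num.min s 1%R)) s)%E).
- by apply/measurable_EFinP; exact: measurable_funTS.
- move=> s /=; rewrite in_itv /= andbT => s0; rewrite lee_fin.
  by rewrite (le_trans (fc _ s0)) // ler_norm.
- apply: integrableZl => //; apply/integrableP; split.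
    by apply/measurable_EFinP; exact: measurable_funTS.
  apply: le_lt_trans nu_levy; rewrite le_eqVlt; apply/orP; left; apply/eqP.
  apply: eq_integral => s.
  rewrite inE /= in_itv /= andbT => s0.
  by rewrite /= ger0_norm // le_min ler01 ltW.
Qed.

Lemma integrable_bernstein (x : R) : 0 <= x ->
  nu.-integrable `]0, +oo[ (EFin \o (fun s => 1 - expR (- x * s))).
Proof.
move=> x0; apply: (@integrable_levy (Num.max x 1)).
  apply: measurable_funB => //; exact: measurableT_comp.
move=> s s0.
have xs : 0 <= x * s by rewrite mulr_ge0 // ltW.
have e1 : expR (- x * s) <= 1 by rewrite -expR0 ler_expR mulNr oppr_le0.
rewrite ger0_norm ?subr_ge0 //.
have e2 := expR_ge1Dx (- x * s).
have e3 := expR_ge0 (- x * s).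
have m1 : 1 <= Num.max x 1 by rewrite le_max lexx orbT.
have m2 : x <= Num.max x 1 by rewrite le_max lexx.
rewrite /Num.min; case: ifP => _.
  have := ler_wpM2r (ltW s0) m2; rewrite mulNr in e2 *; lra.
rewrite mulr1; lra.
Qed.

(** The term of degree k.+1 of the exponential series at lambda * s is at most
    expR (lambda * s) - 1; multiplied by expR (- lambda * s), it is dominated
    by the integrand of bernstein_fun. *)
Lemma integrable_jump (lambda : R) (k : nat) : 0 < lambda ->
  nu.-integrable `]0, +oo[
    (EFin \o (fun s => expR (- lambda * s) * s ^+ k.+1)).
Proof.
move=> l0.
have mI : measurable (`]0, +oo[%classic : set (measurableTypeR R)) by [].
apply: (@le_integrable _ _ _ nu _ mI _ (fun s => (k.+1`!%:R / lambda ^+ k.+1)%:E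
    * (EFin \o (fun s => (1 - expR (- lambda * s))%R)) s)%E).
- apply/measurable_EFinP/measurable_funTS.
  apply: measurable_funM; last first.
    by apply: measurable_funX; exact: measurable_id.
  exact: measurableT_comp.
- move=> s /=; rewrite in_itv /= andbT => s0; rewrite lee_fin.
  have ls : 0 <= lambda * s by rewrite mulr_ge0 // ltW.
  rewrite ger0_norm; last by rewrite mulr_ge0 ?expR_ge0 ?exprn_ge0 // ltW.
  apply: le_trans (ler_norm _).
  rewrite -ler_pdivrMl ?divr_gt0 ?exprn_gt0 ?ltr0n ?fact_gt0 //.
  have := expR_ge1Dxn k ls; rewrite -lerBrDl => H.
  have := ler_wpM2l (expR_ge0 (- lambda * s)) H.
  rewrite mulrBr mulr1 -expRD mulNr addNr expR0; apply: le_trans.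
  rewrite le_eqVlt; apply/orP; left; apply/eqP.
  by rewrite exprMn invf_div; ring.
- by apply: integrableZl => //; apply: integrable_bernstein; exact: ltW.
Qed.

Lemma bernstein_fun_ge0 (x : R) : 0 <= x -> 0 <= bernstein_fun nu x.
Proof.
move=> x0; apply: Rintegral_ge0 => s /=; rewrite in_itv /= andbT => s0.
by rewrite subr_ge0 -expR0 ler_expR mulNr oppr_le0 mulr_ge0 // ltW.
Qed.

(** This is f(lambda) - f(lambda (1-u)) = sum_(k >= 1) u^k r_k with a
    geometric remainder: under the integral sign it is [exp_tail] at x =
    lambda * s, multiplied by expR (- lambda * s). *)
Lemma bernstein_fun_jump_rate (lambda u : R) (K : nat) :
  0 < lambda -> `|u| < 1 ->
  `|bernstein_fun nu (lambda * (1 - u)) - bernstein_fun nu lambda +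
    \sum_(k < K) u ^+ k.+1 * jump_rate lambda nu k.+1| <=
  `|u| ^+ K.+1 * bernstein_fun nu lambda.
Proof.
move=> l0 u1.
have lu : 0 <= lambda * (1 - u).
  by rewrite mulr_ge0 ?ltW // subr_gt0 (le_lt_trans (ler_norm u)).
have mI : measurable (`]0, +oo[%classic : set (measurableTypeR R)) by [].
have i1 := integrable_bernstein lu.
have i2 := integrable_bernstein (ltW l0).
have i3 k := @integrable_jump lambda k l0.
pose c k := u ^+ k.+1 * (lambda ^+ k.+1 / k.+1`!%:R).
pose g k (s : measurableTypeR R) := expR (- lambda * s) * s ^+ k.+1.
rewrite (_ : \sum_(k < K) _ =
    \int[nu]_(s in `]0, +oo[) (\sum_(k < K) c k * g k s)); last first.
  rewrite Rintegral_lincomb //; last by move=> *; exact: i3.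
  by apply: eq_bigr => k _; rewrite /jump_rate mulrA.
have i4 := integrable_lincomb (n := K) (f := g) mI c (fun k _ => i3 k).
have i5 := integrableB mI i1 i2.
rewrite /bernstein_fun -RintegralB // -RintegralD // -RintegralZl //.
apply: le_trans (le_normr_Rintegral _ _) _ => //;
  first exact: (integrableD mI i5 i4).
apply: le_Rintegral => //.
- apply: integrable_norm; exact: (integrableD mI i5 i4).
- exact: (integrableZl mI (`|u| ^+ K.+1) i2).
move=> s /=; rewrite in_itv /= andbT => s0.
have ls : 0 <= lambda * s by rewrite mulr_ge0 // ltW.
have sumE : expR (- lambda * s) *
    (\sum_(k < K.+1) (lambda * s * u) ^+ k / k`!%:R) =
    expR (- lambda * s) + \sum_(k < K) c k * g k s.
  rewrite big_ord_recl /= expr0 fact0 divr1 mulrDr mulr1; congr (_ + _).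
  rewrite mulr_sumr; apply: eq_bigr => k _.
  by rewrite /c /g /bump /= !exprMn; ring.
have prodE : expR (- lambda * s) * expR (lambda * s * u) =
    expR (- (lambda * (1 - u)) * s).
  by rewrite -expRD; congr expR; ring.
have rhsE : expR (- lambda * s) * (`|u| ^+ K.+1 * (expR (lambda * s) - 1)) =
    `|u| ^+ K.+1 * (1 - expR (- lambda * s)).
  by rewrite mulrCA mulrBr mulr1 -expRD mulNr addNr expR0.
have := ler_wpM2l (expR_ge0 (- lambda * s)) (exp_tail K ls (ltW u1)).
rewrite -{1}(ger0_norm (expR_ge0 (- lambda * s))) -normrM mulrBr sumE prodE.
rewrite rhsE => H; apply: le_trans H.
rewrite le_eqVlt; apply/orP; left; apply/eqP.
by rewrite -[RHS]normrN; congr (`|_|); ring.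
Qed.
End levy.

(** * State probabilities and generating functions of counting variables *)

Section prob.
Context d (T : measurableType d) (R : realType) (P : probability T R).

(** Natural numbers form a countable discrete space, so that arbitrary
    conditions on two counting variables define events. *)
Lemma measurable_pair_event (X Y : T -> nat) (Q : nat -> nat -> Prop) :
  measurable_fun setT X -> measurable_fun setT Y ->
  measurable [set w | Q (X w) (Y w)].
Proof.
move=> mX mY.
rewrite (_ : mkset _ = \bigcup_i (X @^-1` [set i] `&` Y @^-1` [set j | Q i j])).
  apply: bigcup_measurable => i _; apply: measurableI.
    by rewrite -[X in measurable X]setTI; exact: mX.
  by rewrite -[X in measurable X]setTI; exact: mY.
by apply/seteqP; split => [w /= Qw|w [i _ [/= <-]]] //; exists (X w).
Qed.

Lemma measurable_event (X : T -> nat) (Q : nat -> Prop) :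
  measurable_fun setT X -> measurable [set w | Q (X w)].
Proof. by move=> mX; exact: (measurable_pair_event (fun i _ => Q i) mX mX). Qed.

Lemma le_prob_ae (A B : set T) : measurable A -> measurable B ->
  {ae P, forall w, A w -> B w} -> (P A <= P B)%E.
Proof.
move=> mA mB [Z [mZ PZ AB]].
rewrite -[P B]adde0 -PZ.
apply: le_trans (measureU2 _ mB mZ).
apply: le_measure; rewrite ?inE //; first exact: measurableU.
move=> w Aw; have [Bw|nBw] := pselect (B w); [by left|right].
by apply: AB => /(_ Aw).
Qed.

Lemma eq_prob_ae (A B : set T) : measurable A -> measurable B ->
  {ae P, forall w, A w <-> B w} -> P A = P B.
Proof.
move=> mA mB AB; apply/eqP; rewrite eq_le !le_prob_ae //.
- by apply: filterS AB => w [].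
- by apply: filterS AB => w [].
Qed.

Lemma state_prob_ge0 (N : R -> T -> nat) k t : 0 <= state_prob P N k t.
Proof. exact: fine_ge0. Qed.

Lemma state_prob_partial_sum_le1 (N : R -> T -> nat) t n :
  measurable_fun setT (N t) -> \sum_(k < n) state_prob P N k t <= 1.
Proof.
move=> mN.
pose A k := [set w | N t w = k].
have mA k : measurable (A k) by exact: (measurable_event (fun i => i = k)).
have pE k : (state_prob P N k t)%:E = P (A k)
  by rewrite /state_prob fineK // fin_num_measure //; exact: mA.
rewrite -lee_fin -sumEFin; under eq_bigr do rewrite pE.
rewrite -(@measure_semi_additive_ord_I _ _ _ P A) //.
- by apply: probability_le1; apply: bigsetU_measurable.
- by move=> i j _ _ [w [/= <- <-]].
- exact: bigsetU_measurable.
Qed.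

(** The random variable u ^+ N t agrees with its truncation when N t < n, and
    is at most |u| ^+ n otherwise. The factor 1 - p_0 is kept because for
    small times it makes the remainder of order t. *)
Lemma pgf_truncation (N : R -> T -> nat) (u t : R) n :
  measurable_fun setT (N t) -> `|u| <= 1 -> (0 < n)%N ->
  `|pgf P N u t - \sum_(k < n) u ^+ k * state_prob P N k t| <=
  `|u| ^+ n * (1 - state_prob P N 0 t).
Proof.
move=> mN u1 n0.
pose A k := [set w | N t w = k].
have mA k : measurable (A k) by exact: (measurable_event (fun i => i = k)).
have iA k : P.-integrable setT (EFin \o \1_(A k)) by exact: integrable_indic.
have pE k : state_prob P N k t = \int[P]_w \1_(A k) w.
  by rewrite /state_prob /Rintegral integral_indic // setIT.
have iu : P.-integrable setT (EFin \o fun w => u ^+ N t w).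
  apply: measurable_bounded_integrable => //.
  - by rewrite (le_lt_trans (probability_le1 _ _)) // ltry.
  - exact: measurableT_comp.
  - exists 1; split => // M M1 w _ /=.
    by rewrite normrX (le_trans _ (ltW M1)) // exprn_ile1.
have i1 : P.-integrable setT (EFin \o fun=> 1).
  exact: finite_measure_integrable_cst.
have pgfE : pgf P N u t = \int[P]_w (u ^+ N t w).
  by rewrite /pgf unlock.
have iS := integrable_lincomb (n := n) measurableT (fun k => u ^+ k)
  (fun k _ => iA k).
have iD := integrableB measurableT iu iS.
have iC := integrableB measurableT i1 (iA 0%N).
have -> : 1 - state_prob P N 0 t = \int[P]_w (1 - \1_(A 0%N) w).
  rewrite RintegralB // -pE; congr (_ - _).
  rewrite Rintegral_cst // mul1r.
  exact: (esym (congr1 fine (probability_setT P))).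
rewrite pgfE; under eq_bigr do rewrite pE.
have := Rintegral_lincomb measurableT (fun k => u ^+ k)
  (fun k (_ : (k < n)%N) => iA k).
rewrite /= => <-; rewrite -RintegralB // -RintegralZl //.
apply: le_trans (le_normr_Rintegral _ _) _ => //.
apply: le_Rintegral => //.
- exact: integrable_norm.
- exact: (integrableZl measurableT (`|u| ^+ n) iC).
move=> w _ /=; have [Nn|nN] := ltnP (N t w) n.
  rewrite (bigD1 (Ordinal Nn)) //= indicE mem_set // mulr1 big1 ?addr0.
    by rewrite subrr normr0 mulr_ge0 ?exprn_ge0 //.
  move=> k kN; rewrite indicE memNset ?mulr0 // => NE.
  by move/eqP: kN; apply; apply: val_inj.
rewrite big1 ?subr0; last first.
  move=> k _; rewrite indicE memNset ?mulr0 // /A /= => NE.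
  by move: (ltn_ord k); rewrite -NE ltnNge nN.
rewrite indicE memNset; last first.
  by rewrite /A /= => NE; rewrite NE leqNgt n0 in nN.
by rewrite subr0 mulr1 normrX ler_wiXn2l.
Qed.
End prob.

(** * The generalized Poisson process *)

Section process.
Context d (T : measurableType d) (R : realType) (P : probability T R).
Variables (lambda : R) (nu : {measure set (measurableTypeR R) -> \bar R}).
Variable N : R -> T -> nat.
Implicit Types (u s t h : R) (k n : nat).
Hypothesis HN : generalized_poisson P N lambda nu.

Let mN t (t0 : 0 <= t) : measurable_fun setT (N t) := gp_measurable HN t0.
Local Notation p k t := (state_prob P N k t).

Lemma prob_start (Q : nat -> Prop) : Q 0%N -> P [set w | Q (N 0 w)] = 1%E.
Proof.
move=> Q0; rewrite -(probability_setT P); apply: eq_prob_ae => //.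
  exact: (measurable_event Q (mN (lexx 0))).
by apply: filterS (gp_start HN) => w /= ->.
Qed.

Lemma start_probE k : p k 0 = (k == 0%N)%:R.
Proof.
rewrite /state_prob; case: k => [|k].
  by rewrite (@prob_start (fun i => i = 0%N)).
suff -> : P [set w | N 0 w = k.+1] = P set0 by rewrite measure0.
apply: eq_prob_ae => //.
  exact: (measurable_event (fun i => i = k.+1) (mN (lexx 0))).
by apply: filterS (gp_start HN) => w /= ->.
Qed.

(** Stationarity moves the increment to time 0, where N vanishes almost
    surely. *)
Lemma increment_law (A : set int) t h : 0 <= t -> 0 <= h ->
  P [set w | A (increment N t (t + h) w)] = P [set w | A (N h w)%:Z].
Proof.
move=> t0 h0; rewrite (gp_stationary HN A t0 (lexx 0) h0) add0r.
apply: eq_prob_ae.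
- apply: (measurable_pair_event (fun i j => A (j%:Z - i%:Z))).
  + exact: mN.
  + exact: mN.
- exact: (measurable_event (fun i => A i%:Z) (mN h0)).
- apply: filterS (gp_start HN) => w /= N0.
  by rewrite /increment N0 subr0.
Qed.

Lemma increment_probE t h k : 0 <= t -> 0 <= h ->
  increment_prob P N t h k = p k h.
Proof.
move=> t0 h0; rewrite /increment_prob (increment_law (fun i => i = k%:Z)) //.
by congr (fine (P _)); apply/seteqP; split => w /=; [case|move=> ->].
Qed.

(** A negative increment is as likely as a negative value of N h. *)
Lemma increment_ge0 t h : 0 <= t -> 0 <= h ->
  {ae P, forall w, (N t w <= N (t + h) w)%N}.
Proof.
move=> t0 h0; have th0 : 0 <= t + h by rewrite addr_ge0.
apply/(negligibleP _).
  exact: (measurable_pair_event (fun i j => ~ (i <= j)%N) (mN t0) (mN th0)).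
rewrite (_ : ~` _ = [set w | [set i : int | i < 0] (increment N t (t + h) w)]).
  apply: (etrans (increment_law [set i : int | i < 0] t0 h0)).
  rewrite (_ : mkset _ = set0) ?measure0 //.
  by apply/seteqP; split => w.
apply/seteqP; split => w /=; rewrite /increment subr_lt0 ltz_nat.
  by move/negP; rewrite -ltnNge.
by rewrite ltnNge => /negP.
Qed.

(** Independence of the increments over [0, t) and [t, t + h), the former
    being N t almost surely. *)
Lemma joint_prob t h (i j : nat) : 0 < t -> 0 < h ->
  P [set w | N t w = i /\ increment N t (t + h) w = j] =
  (p i t * p j h)%:E.
Proof.
move=> t0 h0; have th0 : 0 < t + h by rewrite addr_gt0.
(* the times 0 < t < t + h, continued by a constant *)
pose tt (n : nat) := match n with 0%N => 0 | 1%N => t | _ => t + h end.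
pose A (n : nat) : set int := if n == 0%N then [set i%:Z] else [set j%:Z].
have ttlt n : (n < 2)%N -> tt n < tt n.+1.
  by case: n => [|[|]] //= _; rewrite ltrDl.
have E n s r : 0 <= s -> 0 <= r ->
    P [set w | increment N s (s + r) w = n%:Z] = (p n r)%:E.
  move=> s0 r0; apply: (etrans (increment_law [set n%:Z] s0 r0)).
  rewrite /state_prob fineK; last first.
    rewrite fin_num_measure //.
    exact: (measurable_event (fun i => i = n) (mN r0)).
  by congr (P _); apply/seteqP; split => w /=; [case|move=> ->].
have := gp_independent HN A (lexx 0 : 0 <= tt 0%N) ttlt.
rewrite big_ord_recl big_ord1 /= /A /=.
have := E i 0 t (lexx 0) (ltW t0); rewrite add0r => ->.
rewrite E ?ltW // -EFinM => <-; apply: eq_prob_ae.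
- apply: (measurable_pair_event (fun a b => a = i /\ b%:Z - a%:Z = j%:Z)).
  + by apply: mN; exact: ltW.
  + by apply: mN; exact: ltW.
- rewrite (_ : mkset _ =
     [set w | increment N 0 t w = i%:Z] `&`
     [set w | increment N t (t + h) w = j%:Z]).
    apply: measurableI.
    + by apply: (measurable_pair_event (fun a b => b%:Z - a%:Z = i%:Z));
        apply: mN => //; exact: ltW.
    + by apply: (measurable_pair_event (fun a b => b%:Z - a%:Z = j%:Z));
        apply: mN => //; exact: ltW.
  apply/seteqP; split => w /=.
    by move=> H; split; [exact: (H 0%N)|exact: (H 1%N)].
  by move=> [H0 H1] [|[|]].
- apply: filterS (gp_start HN) => w /= N0; rewrite /increment; split.
    by move=> [Ni H] [|[|]] //= _; rewrite N0 subr0 Ni.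
  move=> H; split; last exact: (H 1%N).
  by have := H 0%N isT; rewrite /= N0 subr0 => -[].
Qed.

(** The event N (t + h) = k splits according to the increment m over [t, t +
    h), which almost surely lies between 0 and k. *)
Lemma state_prob_convolution t h k : 0 < t -> 0 < h ->
  p k (t + h) = \sum_(m < k.+1) p (k - m)%N t * p m h.
Proof.
move=> t0 h0; have th0 : 0 < t + h by rewrite addr_gt0.
pose F m := [set w | N t w = (k - m)%N /\ increment N t (t + h) w = m%:Z].
have mF m : measurable (F m).
  apply: (measurable_pair_event
    (fun a b => a = (k - m)%N /\ b%:Z - a%:Z = m%:Z)).
  + by apply: mN; exact: ltW.
  + by apply: mN; exact: ltW.
apply: EFin_inj; rewrite -sumEFin.
under eq_bigr do rewrite -joint_prob //.
rewrite -(@measure_semi_additive_ord_I _ _ _ P F) //; last 2 first.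
- by move=> i j _ _ [w [[_ H1] [_ H2]]]; rewrite H1 in H2; case: H2.
- exact: bigsetU_measurable.
have mk := measurable_event (fun i => i = k) (mN (ltW th0)).
rewrite /state_prob fineK ?fin_num_measure //.
apply: eq_prob_ae => //; first exact: bigsetU_measurable.
apply: filterS (increment_ge0 (ltW t0) (ltW h0)) => w /= le; split.
  move=> Nk; rewrite -bigcup_mkord; exists (k - N t w)%N => /=.
    by rewrite ltnS leq_subr.
  rewrite /F /= /increment Nk subKn -?Nk //; split => //.
  by rewrite Nk subzn // -Nk.
rewrite -bigcup_mkord => -[m /= mk1 [Nt]]; rewrite /increment Nt => /eqP.
rewrite subr_eq => /eqP; rewrite -PoszD => -[->].
by rewrite subnKC.
Qed.

Lemma state_prob_le1 k t : 0 <= t -> p k t <= 1.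
Proof.
move=> t0; have := state_prob_partial_sum_le1 P k.+1 (mN t0).
rewrite big_ord_recr /=; apply: le_trans; rewrite lerDr sumr_ge0 // => i _.
exact: state_prob_ge0.
Qed.

Lemma norm_state_prob_le1 k t : 0 <= t -> `|p k t| <= 1.
Proof. by move=> t0; rewrite ger0_norm ?state_prob_ge0 // state_prob_le1. Qed.

(** The error of the first-order expansion of p_k at time 0. *)
Definition step_error k h :=
  p k h - (if k is 0 then 1 - h * bernstein_fun nu lambda
           else h * jump_rate lambda nu k).

Lemma negligible_step_error k : negligible_step (step_error k).
Proof.
have H : (fun h => increment_prob P N 0 h k) =
    (fun h => if k is 0 then 1 - h * bernstein_fun nu lambda
           else h * jump_rate lambda nu k) +o_ (0^'+) (fun h : R => h).
  by case: k => [|k]; [exact: gp_no_jump HN _ _|exact: gp_jump HN _ _ _ _].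
move=> eps e0; move/eqaddoP: H => /(_ _ e0) H.
near=> h.
have h0 : 0 < h by near: h; exact: nbhs_right_gt.
rewrite -{2}(gtr0_norm h0) /step_error -(increment_probE k (lexx 0) (ltW h0)).
by near: h; exact: H.
Unshelve. all: by end_near. Qed.

Definition state_rate k t :=
  - bernstein_fun nu lambda * p k t +
  \sum_(m < k) jump_rate lambda nu m.+1 * p (k - m.+1)%N t.

(** The quantity in the norm is the convolution of p_(k-m)(s) with the errors
    at h; as probabilities are at most 1, the bound is independent of s. *)
Lemma state_prob_step k s h : 0 < s -> 0 < h ->
  `|p k (s + h) - p k s - h * state_rate k s| <=
  \sum_(m < k.+1) `|step_error m h|.
Proof.
move=> s0 h0; rewrite state_prob_convolution //.
rewrite (_ : _ - _ = \sum_(m < k.+1) p (k - m)%N s * step_error m h).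
  rewrite (le_trans (ler_norm_sum _ _ _)) //; apply: ler_sum => m _.
  by rewrite normrM ler_piMl // norm_state_prob_le1 // ltW.
rewrite /state_rate !big_ord_recl /= subn0 mulrDr mulr_sumr.
rewrite [X in _ - (_ + X)](eq_bigr (fun m : 'I_k =>
  p (k - m.+1)%N s * (h * jump_rate lambda nu m.+1))); last first.
  by move=> m _; ring.
have -> : \sum_(m < k) p (k - bump 0 m)%N s * step_error (bump 0 m) h =
   \sum_(m < k) p (k - bump 0 m)%N s * p (bump 0 m) h -
   \sum_(m < k) p (k - m.+1)%N s * (h * jump_rate lambda nu m.+1).
  by rewrite -sumrB; apply: eq_bigr => m _; rewrite -mulrBr.
by rewrite /step_error; ring.
Qed.

Lemma continuous_state_prob k t : 0 < t ->
  {for t, continuous (state_prob P N k)}.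
Proof.
move=> t0; apply: (continuous_of_steps (L := state_rate k)
  (e := fun h => \sum_(m < k.+1) `|step_error m h|)
  (C := `|bernstein_fun nu lambda| + \sum_(m < k) `|jump_rate lambda nu m.+1|)).
- by apply: negligible_step_sum => m _; exact: negligible_step_error.
- by [].
- move=> s s0; rewrite (le_trans (ler_normD _ _)) // lerD //.
    by rewrite normrM normrN ler_piMr // norm_state_prob_le1 // ltW.
  rewrite (le_trans (ler_norm_sum _ _ _)) //; apply: ler_sum => m _.
  by rewrite normrM ler_piMr // norm_state_prob_le1 // ltW.
- exact: state_prob_step.
Qed.

Lemma is_derive_state_prob k t : 0 < t ->
  is_derive t 1 (state_prob P N k) (state_rate k t).
Proof.
move=> t0.
apply: (derive_of_steps (e := fun h => \sum_(m < k.+1) `|step_error m h|)).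
- by apply: negligible_step_sum => m _; exact: negligible_step_error.
- by [].
- apply: cvgD; first by apply: cvgMr; exact: continuous_state_prob.
  apply: cvg_big => [|m _]; first exact: add_continuous.
  by apply: cvgMr; exact: continuous_state_prob.
- exact: state_prob_step.
Qed.

Lemma pgf_start u : `|u| < 1 -> pgf P N u 0 = 1.
Proof.
move=> u1; have := @pgf_truncation _ _ _ P N u 0 1 (mN (lexx 0)) (ltW u1) isT.
rewrite big_ord1 start_probE eqxx subrr mulr0 expr0 mul1r normr_le0 subr_eq0.
by move/eqP.
Qed.

Lemma norm_pgf_sub_le u t n : 0 <= t -> `|u| <= 1 ->
  `|pgf P N u t - \sum_(k < n.+1) u ^+ k * p k t| <= `|u| ^+ n.+1.
Proof.
move=> t0 u1; apply: (le_trans (pgf_truncation P (mN t0) u1 (ltn0Sn n))).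
by rewrite ler_piMr ?exprn_ge0 // gerBl state_prob_ge0.
Qed.

Lemma norm_pgf_le1 u t : 0 <= t -> `|u| <= 1 -> `|pgf P N u t| <= 1.
Proof.
move=> t0 u1.
have := pgf_truncation P (n := 1) (mN t0) u1 isT.
rewrite big_ord1 expr0 mul1r expr1 => H.
rewrite -[pgf _ _ _ _](subrK (p 0 t)) (le_trans (ler_normD _ _)) //.
have p1 := state_prob_le1 0 t0.
rewrite (ger0_norm (state_prob_ge0 _ _ _ _)) -lerBrDr (le_trans H) //.
by rewrite ler_piMl // subr_ge0.
Qed.

(** Both sides are approximated within a multiple of |u|^n by truncations,
    where the convolution identity and [cauchy_truncation] compare them. *)
Lemma pgfD u t h : `|u| < 1 -> 0 < t -> 0 < h ->
  pgf P N u (t + h) = pgf P N u t * pgf P N u h.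
Proof.
move=> u1 t0 h0.
(* 4 counts the three truncations and the truncated product *)
apply: (@eq_of_geometric _ _ _ u 4 u1) => n.
have th0 : 0 < t + h by rewrite addr_gt0.
pose S s := \sum_(k < n.+1) u ^+ k * p k s.
have A s : 0 < s -> `|pgf P N u s - S s| <= `|u| ^+ n.
  move=> s0; apply: (le_trans (norm_pgf_sub_le n (ltW s0) (ltW u1))).
  by rewrite ler_wiXn2l // ltW.
have S1 s : 0 < s -> \sum_(k < n.+1) p k s <= 1.
  by move=> s0; exact: (state_prob_partial_sum_le1 P n.+1 (mN (ltW s0))).
have NS s : 0 < s -> `|S s| <= 1.
  move=> s0; rewrite (le_trans (ler_norm_sum _ _ _)) //.
  rewrite (le_trans _ (S1 s s0)) //.
  apply: ler_sum => k _; rewrite normrM normrX.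
  rewrite (ger0_norm (state_prob_ge0 _ _ _ _)).
  by rewrite ler_piMl ?state_prob_ge0 // exprn_ile1 // ltW.
have B : `|S (t + h) - S t * S h| <= `|u| ^+ n.
  rewrite /S; under eq_bigr do rewrite state_prob_convolution //.
  apply: (le_trans (@cauchy_truncation _ u (fun k => p k t) (fun k => p k h)
    n.+1 (ltW u1) _ _ (S1 t t0) (S1 h h0))).
  - by move=> k; exact: state_prob_ge0.
  - by move=> k; exact: state_prob_ge0.
  - by rewrite ler_wiXn2l // ltW.
have -> : pgf P N u (t + h) - pgf P N u t * pgf P N u h =
    (pgf P N u (t + h) - S (t + h)) + (S (t + h) - S t * S h) -
    ((pgf P N u t - S t) * pgf P N u h + S t * (pgf P N u h - S h)) by ring.
have C : `|(pgf P N u t - S t) * pgf P N u h| <= `|u| ^+ n.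
  rewrite normrM (le_trans _ (A t t0)) // ler_piMr //.
  by apply: norm_pgf_le1; exact: ltW.
have D : `|S t * (pgf P N u h - S h)| <= `|u| ^+ n.
  by rewrite normrM (le_trans _ (A h h0)) // ler_piMl // NS.
have An := A _ th0.
apply: (le_trans (ler_normB _ _)).
have := ler_normD (pgf P N u (t + h) - S (t + h)) (S (t + h) - S t * S h).
have := ler_normD ((pgf P N u t - S t) * pgf P N u h)
  (S t * (pgf P N u h - S h)).
lra.
Qed.

Hypothesis lambda_gt0 : 0 < lambda.
Hypothesis nu_levy :
  (\int[nu]_(s in `]0%R, +oo[) (Num.min s 1)%:E < +oo)%E.

(** The error of the first-order expansion of the generating function at time
    0. *)
Definition pgf_error u h :=
  pgf P N u h - 1 + h * bernstein_fun nu (lambda * (1 - u)).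

(** Both the generating function and the Bernstein function are cut at rank n.
    The first part of the bound is o(h) for fixed n; the second is linear in h
    with a coefficient that is small for large n. *)
Lemma pgf_error_le u h n : `|u| < 1 -> 0 < h ->
  `|pgf_error u h| <= 2 * (\sum_(k < n.+1) `|step_error k h|) +
    2 * bernstein_fun nu lambda * `|u| ^+ n.+1 * h.
Proof.
move=> u1 h0.
have H1 := pgf_truncation P (mN (ltW h0)) (ltW u1) (ltn0Sn n).
have H2 := bernstein_fun_jump_rate nu_levy n lambda_gt0 u1.
have f0 := bernstein_fun_ge0 nu (ltW lambda_gt0).
set f := bernstein_fun nu lambda in H2 f0 *.
set c := bernstein_fun nu _ in H2.
set J := \sum_(k < n) _ in H2.
set S := \sum_(k < n.+1) u ^+ k * _ in H1.
pose E := \sum_(k < n.+1) u ^+ k * step_error k h.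
(* E collects the errors of the expansions of p_0, ..., p_n *)
have SE : S = E + 1 - h * f + h * J.
  rewrite /S /E !big_ord_recl /= expr0 !mul1r /step_error /J mulr_sumr.
  have -> : \sum_(i < n) u ^+ bump 0 i * (p (bump 0 i) h -
      h * jump_rate lambda nu (bump 0 i)) =
      \sum_(i < n) u ^+ bump 0 i * p (bump 0 i) h -
      \sum_(i < n) h * (u ^+ i.+1 * jump_rate lambda nu i.+1).
    by rewrite -sumrB; apply: eq_bigr => i _; rewrite /bump /=; ring.
  by rewrite -/f; ring.
have NE : `|E| <= \sum_(k < n.+1) `|step_error k h|.
  rewrite (le_trans (ler_norm_sum _ _ _)) //; apply: ler_sum => k _.
  by rewrite normrM normrX ler_piMl // exprn_ile1 // ltW.
have N0 : 1 - p 0 h <= h * f + \sum_(k < n.+1) `|step_error k h|.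
  have : `|step_error 0 h| <= \sum_(k < n.+1) `|step_error k h|.
    by rewrite big_ord_recl lerDl sumr_ge0.
  have := ler_norm (- step_error 0 h); rewrite normrN /step_error -/f; lra.
have U1 : `|u| ^+ n.+1 <= 1 by rewrite exprn_ile1 // ltW.
have U0 : 0 <= `|u| ^+ n.+1 by rewrite exprn_ge0.
set q := `|u| ^+ n.+1 in H1 H2 U1 U0 *.
set e := \sum_(k < n.+1) `|_| in NE N0 *.
have e0 : 0 <= e by rewrite sumr_ge0.
have -> : pgf_error u h = (pgf P N u h - S) + h * (c - f + J) + E.
  by rewrite SE /pgf_error -/c; ring.
have H3 : `|h * (c - f + J)| <= h * (q * f).
  by rewrite normrM gtr0_norm // ler_pM2l.
have H4 : q * (1 - p 0 h) <= q * (h * f) + e.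
  apply: (le_trans (ler_wpM2l U0 N0)); rewrite mulrDr lerD2l.
  by rewrite ler_piMl.
have := ler_normD (pgf P N u h - S + h * (c - f + J)) E.
have := ler_normD (pgf P N u h - S) (h * (c - f + J)).
lra.
Qed.

Lemma negligible_pgf_error u : `|u| < 1 -> negligible_step (pgf_error u).
Proof.
move=> u1 eps e0.
have f0 := bernstein_fun_ge0 nu (ltW lambda_gt0).
have [n Hn] : exists n, 2 * bernstein_fun nu lambda * `|u| ^+ n.+1 <= eps / 2.
  have c : 2 * bernstein_fun nu lambda * `|u| ^+ n @[n --> \oo] -->
      2 * bernstein_fun nu lambda * 0.
    by apply: cvgMr; apply: cvg_expr; rewrite normr_id.
  have e2 : 0 < eps / 2 by rewrite divr_gt0.
  move/cvgrPdist_le: c => /(_ _ e2) [n _ Hn].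
  exists n; have := Hn n.+1 (leqnSn n) => /=.
  rewrite mulr0 sub0r normrN ger0_norm // !mulr_ge0 // exprn_ge0 //.
have e4 : 0 < eps / 4 by rewrite divr_gt0.
have Hs := negligible_step_sum (n := n.+1)
  (fun k _ => negligible_step_error k) e4.
near=> h.
have h0 : 0 < h by near: h; exact: nbhs_right_gt.
apply: (le_trans (pgf_error_le n u1 h0)).
have : `|\sum_(k < n.+1) `|step_error k h| | <= eps / 4 * h by near: h.
rewrite ger0_norm ?sumr_ge0 // => Hs'.
have := ler_wpM2r (ltW h0) Hn.
lra.
Unshelve. all: by end_near. Qed.

(** By [pgfD] the quantity in the norm is the error at h multiplied by pgf P N
    u s, of norm at most 1. *)
Lemma pgf_step u s h : `|u| < 1 -> 0 < s -> 0 < h ->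
  `|pgf P N u (s + h) - pgf P N u s -
    h * (- bernstein_fun nu (lambda * (1 - u)) * pgf P N u s)| <=
  `|pgf_error u h|.
Proof.
move=> u1 s0 h0; rewrite pgfD // (_ : _ - _ = pgf P N u s * pgf_error u h).
  by rewrite normrM ler_piMl // norm_pgf_le1 // ltW.
by rewrite /pgf_error; ring.
Qed.

Lemma is_derive_pgf u t : `|u| < 1 -> 0 < t ->
  is_derive t 1 (pgf P N u)
    (- bernstein_fun nu (lambda * (1 - u)) * pgf P N u t).
Proof.
move=> u1 t0; set c := bernstein_fun nu _.
have He := negligible_step_norm (negligible_pgf_error u1).
apply: (derive_of_steps (L := fun t => - c * pgf P N u t) He t0).
  apply: cvgMr; apply: (continuous_of_steps (L := fun t => - c * pgf P N u t)
    (C := `|c|) He t0).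
    by move=> s s0; rewrite normrM normrN ler_piMr // norm_pgf_le1 // ltW.
  by move=> s h s0 h0; exact: pgf_step.
by move=> s h s0 h0; exact: pgf_step.
Qed.

Lemma pgf_right_continuous0 u : `|u| < 1 ->
  pgf P N u h @[h --> 0^'+] --> (1 : R).
Proof.
move=> u1; set c := bernstein_fun nu (lambda * (1 - u)).
apply/cvgrPdist_le => eps e0.
have C0 : 0 < `|c| + 1 by rewrite ltr_wpDl.
near=> h.
have h0 : 0 < h by near: h; exact: nbhs_right_gt.
have E : `|pgf_error u h| <= 1 * h.
  by near: h; exact: negligible_pgf_error.
have he : h <= eps / (`|c| + 1).
  by near: h; apply: nbhs_right_le; rewrite divr_gt0.
rewrite (_ : _ - _ = h * c - pgf_error u h); last first.
  by rewrite /pgf_error -/c; ring.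
rewrite (le_trans (ler_normB _ _)) // normrM gtr0_norm //.
move: he; rewrite ler_pdivlMr //; lra.
Unshelve. all: by end_near. Qed.

Lemma pgfE u t : `|u| < 1 -> 0 <= t ->
  pgf P N u t = expR (- t * bernstein_fun nu (lambda * (1 - u))).
Proof.
move=> u1; rewrite le_eqVlt => /predU1P[<-|t0].
  by rewrite oppr0 mul0r expR0 pgf_start.
set c := bernstein_fun nu _.
pose H s := pgf P N u s * expR (s * c).
have DH s : 0 < s -> is_derive s 1 H 0.
  move=> s0; have D1 := is_derive_pgf u1 s0.
  have D2 : is_derive s 1 (fun s => expR (s * c)) (c * expR (s * c)).
    have D4 : is_derive s 1 (fun s => s * c) c.
      apply: (is_derive_eq (is_deriveM (is_derive_id s 1) (is_derive_cst c s 1))).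
      by rewrite scaler0 add0r /GRing.scale /= mulr1.
    rewrite mulrC.
    exact: (@is_derive1_comp _ _ _ _ _ _ (is_derive_expR _) D4).
  have D3 := is_deriveM D1 D2.
  apply: (is_derive_eq D3); rewrite /GRing.scale /= -/c; ring.
have Hc : {within `[0, t], continuous H}.
  apply/continuous_within_itvP => //; split.
  - move=> s; rewrite in_itv /= => /andP[s0 _].
    by apply/differentiable_continuous/derivable1_diffP; case: (DH s s0).
  - rewrite /H pgf_start //; apply: cvgM; first exact: pgf_right_continuous0.
    apply: cvg_at_right_filter.
    apply: (@continuous_comp _ _ _ (fun s => s * c) expR).
      exact: mulrr_continuous.
    exact: continuous_expR.
  - apply: cvg_at_left_filter.
    by apply/differentiable_continuous/derivable1_diffP; case: (DH t t0).
have [s _] : exists2 s, s \in `]0, t[%R & H t - H 0 = 0 * (t - 0).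
  apply: MVT => // s; rewrite in_itv /= => /andP[s0 _]; exact: DH.
rewrite mul0r => /eqP; rewrite subr_eq0 => /eqP.
rewrite /H pgf_start // mul0r expR0 mulr1 => HE.
apply: (mulIf (lt0r_neq0 (expR_gt0 (t * c)))).
by rewrite HE -expRD mulNr addNr expR0.
Qed.
End process.

Theorem theorem2p1 (R : realType) (d : measure_display) (T : measurableType d)
    (P : probability T R) (lambda : R)
    (nu : {measure set (measurableTypeR R) -> \bar R}) (N : R -> T -> nat)
    (lambda_gt0 : 0 < lambda)
    (nu_levy : (\int[nu]_(s in `]0%R, +oo[) (Num.min s 1)%:E < +oo)%E)
    (HN : generalized_poisson P N lambda nu) :
  [/\ forall (k : nat) (t : R), 0 < t ->
        is_derive t 1 (state_prob P N k)
          (- bernstein_fun nu lambda * state_prob P N k t +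
           \sum_(1 <= m < k.+1)
             lambda ^+ m / m`!%:R * state_prob P N (k - m)%N t *
             \int[nu]_(s in `]0, +oo[) (expR (- s * lambda) * s ^+ m)),
      state_prob P N 0 0 = 1 /\
        (forall k : nat, (1 <= k)%N -> state_prob P N k 0 = 0),
      forall u t : R, `|u| < 1 -> 0 < t ->
        is_derive t 1 (pgf P N u)
          (- bernstein_fun nu (lambda * (1 - u)) * pgf P N u t),
      forall u : R, `|u| < 1 -> pgf P N u 0 = 1
    & forall u t : R, `|u| < 1 -> 0 <= t ->
        pgf P N u t = expR (- t * bernstein_fun nu (lambda * (1 - u)))].
Proof.
split.
- move=> k t t0; apply: (is_derive_eq (is_derive_state_prob HN k t0)).
  rewrite /state_rate; congr (_ + _); rewrite big_add1 big_mkord.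
  apply: eq_bigr => m _; rewrite /jump_rate mulrAC; congr (_ * _).
  by apply: eq_Rintegral => s _; rewrite !mulNr mulrC [lambda * s]mulrC mulrC.
- split; first by rewrite (start_probE HN).
  by case=> // k _; rewrite (start_probE HN).
- by move=> u t u1 t0; exact: is_derive_pgf.
- by move=> u u1; exact: (pgf_start HN).
- by move=> u t u1 t0; exact: pgfE.
Qed.
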